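(* Let $P_U^\star$ and $(L_u^\star)_{u\in\mathcal U}$ be an optimal solution of the primal problem $$\min_{P_U,\,(L_u)_{u\in\mathcal U}}\; -\sum_{u\in\mathcal U}P_U(u)L_u^\top V L_u$$ subject to $$\sum_{u\in\mathcal U}P_U(u)L_u^\top L_u\le \frac{2R}{\epsilon^2},\qquad \sum_{u\in\mathcal U}P_U(u)L_u^\top\Lambda L_u\le\frac{2\Theta}{\epsilon^2},$$ $$\sqrt{P_X}^{\top}L_u=0\ \ \forall u\in\mathcal U,\qquad \sum_{u\in\mathcal U}P_U(u)[\sqrt{P_X}]L_u=\mathbf 0,\qquad \sum_{u\in\mathcal U}P_U(u)=1,\quad P_U(u)\ge 0\ \ \forall u\in\mathcal U,$$ and let $\nu^\star,\rho^\star,\boldsymbol\xi^\star=(\xi^\star(u))_{u\in\mathcal U},\boldsymbol\mu^\star$ be the optimal solution of the dual problem associated with the Lagrangian $\mathcal L$ given in the context (formed at $P_U=P_U^\star$). Assume that a constraint qualification holds, so that the KKT conditions hold at these primal and dual optimal solutions. Then $$\boldsymbol\mu^\star=-\Big(\sum_{u'\in\mathcal U}\xi^\star(u')\Big)\sqrt{P_X},$$ $$\xi^\star(u)=\Big(\sum_{u'\in\mathcal U}\xi^\star(u')\Big)P_U^\star(u)\quad\text{for all }u\in\mathcal U,$$ and $$K(\nu^\star,\rho^\star)L_u^\star=0\quad\text{for all }u\in\mathcal U,$$ where $K(\nu,\rho)=-V+\nu\Lambda+\rho I$ and $I$ is the $|\mathcal X|\times|\mathcal X|$ identity matrix.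
   Context: $\mathcal U,\mathcal X,\mathcal Y,\mathcal Z$ are finite alphabets. $P_X$ is a fixed probability vector on $\mathcal X$ with all entries positive. $P_{Y|X}$ and $P_{Z|X}$ are column-stochastic transition matrices of sizes $|\mathcal Y|\times|\mathcal X|$ and $|\mathcal Z|\times|\mathcal X|$ (discrete memoryless channels), and the output distributions $P_Y=P_{Y|X}P_X$ and $P_Z=P_{Z|X}P_X$ have all entries positive. For a probability vector $P$ with positive entries, $\sqrt P$ denotes the vector with entries $\sqrt{P(x)}$, $[\sqrt P]$ the diagonal matrix with these entries, and $[\sqrt P]^{-1}$ its inverse. The divergence transfer matrices are $B_{Y|X}=[\sqrt{P_Y}]^{-1}P_{Y|X}[\sqrt{P_X}]$ and $B_{Z|X}=[\sqrt{P_Z}]^{-1}P_{Z|X}[\sqrt{P_X}]$, and $$V=B_{Y|X}^\top B_{Y|X},\qquad \Lambda=B_{Z|X}^\top B_{Z|X}.$$ The constants $R>0$, $\Theta>0$ and $\epsilon>0$ are given. The primal variables are a probability vector $P_U$ on $\mathcal U$ and vectors $L_u\in\mathbb R^{|\mathcal X|}$, $u\in\mathcal U$. The Lagrangian, with multipliers $\nu\ge0$, $\rho\ge 0$, $\boldsymbol\xi\in\mathbb R^{|\mathcal U|}$, $\boldsymbol\mu\in\mathbb R^{|\mathcal X|}$, is $$\mathcal L=-\sum_{u}P_U(u)L_u^\top VL_u+\nu\Big(\sum_uP_U(u)L_u^\top\Lambda L_u-\frac{2\Theta}{\epsilon^2}\Big)+\rho\Big(\sum_uP_U(u)L_u^\top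 L_u-\frac{2R}{\epsilon^2}\Big)+\sum_u\xi(u)\sqrt{P_X}^{\top}L_u+\sum_uP_U(u)\boldsymbol\mu^\top L_u .$$ The dual function is $\mathcal G(\nu,\rho,\boldsymbol\xi,\boldsymbol\mu)=\inf_{(L_u)}\mathcal L$, and the dual problem is to maximize $\mathcal G$ over $\nu,\rho\ge0$, $\boldsymbol\xi$, $\boldsymbol\mu$. The KKT conditions are: primal feasibility, $\nu^\star,\rho^\star\ge 0$, complementary slackness for the two inequality constraints on the $L_u$, and vanishing of the gradient of $\mathcal L$ with respect to each $L_u$, $u\in\mathcal U$, at the optimal values.
   Formalization: The third conclusion, K(ν*,ρ* )L_u* = 0, is proved only for u with P_U*(u) > 0; for P_U*(u) = 0 it fails, since such an L_u* is constrained only by orthogonality to √P_X and can be any vector orthogonal to it. *)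

(* Defs.v *)
From HB Require Import structures.
From mathcomp Require Import all_boot all_order all_algebra.
From mathcomp Require Import all_classical all_reals all_analysis.

Set Implicit Arguments.
Unset Strict Implicit.
Unset Printing Implicit Defensive.

Import Order.TTheory GRing.Theory Num.Theory.
Import numFieldNormedType.Exports.
Local Open Scope classical_set_scope.
Local Open Scope ring_scope.

(* The alphabets of X, Y, Z are 'I_nX, 'I_nY, 'I_nZ, so that probability
   vectors on them are columns and channels are matrices whose (y, x) entry
   is the probability of y given x. *)

Section Channels.
Context {R : realType}.

Definition prob_vec n (P : 'cV[R]_n) : Prop :=
  (forall i, 0 <= P i 0) /\ \sum_i P i 0 = 1.

Definition pos_vec n (P : 'cV[R]_n) : Prop := forall i, 0 < P i 0.

Definition col_stochastic m n (W : 'M[R]_(m, n)) : Prop :=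
  forall j, prob_vec (col j W).

Definition sqrt_vec n (P : 'cV[R]_n) : 'cV[R]_n := map_mx Num.sqrt P.

Definition sqrt_diag n (P : 'cV[R]_n) : 'M[R]_n := diag_mx (sqrt_vec P)^T.

(* Divergence transfer matrix of the channel W with input distribution P;
   W *m P is the output distribution. *)
Definition dtm m n (W : 'M[R]_(m, n)) (P : 'cV[R]_n) : 'M[R]_(m, n) :=
  invmx (sqrt_diag (W *m P)) *m W *m sqrt_diag P.

Definition dot n (a b : 'cV[R]_n) : R := (a^T *m b) 0 0.

Definition qform n (M : 'M[R]_n) (a : 'cV[R]_n) : R := (a^T *m M *m a) 0 0.

Definition gradient n (f : 'cV[R]_n -> R) (a : 'cV[R]_n) : 'cV[R]_n :=
  \col_i 'D_(delta_mx i 0) f a.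

End Channels.

Section Problem.
Context {R : realType} {U : finType} {n : nat}.
Variables (PX : 'cV[R]_n) (V Lam : 'M[R]_n) (rate Theta eps : R).
Implicit Types (PU xi : U -> R) (L : U -> 'cV[R]_n) (mu : 'cV[R]_n).
Implicit Types nu rho : R.

Definition objective PU L : R := - \sum_u PU u * qform V (L u).

Definition primal_feasible PU L : Prop :=
  [/\ \sum_u PU u * dot (L u) (L u) <= 2 * rate / eps ^+ 2,
      \sum_u PU u * qform Lam (L u) <= 2 * Theta / eps ^+ 2,
      forall u, dot (sqrt_vec PX) (L u) = 0,
      \sum_u PU u *: (sqrt_diag PX *m L u) = 0
    & \sum_u PU u = 1 /\ forall u, 0 <= PU u].

Definition primal_optimal PU L : Prop :=
  primal_feasible PU L /\
  forall PU' L', primal_feasible PU' L' -> objective PU L <= objective PU' L'.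

Definition lagrangian PU nu rho xi mu L : R :=
  - \sum_u PU u * qform V (L u)
  + nu * (\sum_u PU u * qform Lam (L u) - 2 * Theta / eps ^+ 2)
  + rho * (\sum_u PU u * dot (L u) (L u) - 2 * rate / eps ^+ 2)
  + \sum_u xi u * dot (sqrt_vec PX) (L u)
  + \sum_u PU u * dot mu (L u).

Definition dual_function PU nu rho xi mu : \bar R :=
  ereal_inf (range (fun L => (lagrangian PU nu rho xi mu L)%:E)).

Definition dual_optimal PU nu rho xi mu : Prop :=
  [/\ 0 <= nu, 0 <= rho
    & forall nu' rho' xi' mu', 0 <= nu' -> 0 <= rho' ->
      (dual_function PU nu' rho' xi' mu' <= dual_function PU nu rho xi mu)%E].

Definition lagrangian_gradient PU nu rho xi mu L (u : U) : 'cV[R]_n :=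
  gradient (fun l => lagrangian PU nu rho xi mu [eta L with u |-> l]) (L u).

Definition KKT PU L nu rho xi mu : Prop :=
  [/\ primal_feasible PU L,
      0 <= nu /\ 0 <= rho,
      nu * (\sum_u PU u * qform Lam (L u) - 2 * Theta / eps ^+ 2) = 0,
      rho * (\sum_u PU u * dot (L u) (L u) - 2 * rate / eps ^+ 2) = 0
    & forall u, lagrangian_gradient PU nu rho xi mu L u = 0].

Definition Kmx nu rho : 'M[R]_n := - V + nu *: Lam + rho%:M.

End Problem.

(* Main.v *)
Require Import Defs.
From HB Require Import structures.
From mathcomp Require Import all_boot all_order all_algebra.
From mathcomp Require Import all_classical all_reals all_analysis.
From mathcomp Require Import ring.

Set Implicit Arguments.
Unset Strict Implicit.
Unset Printing Implicit Defensive.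

Import Order.TTheory GRing.Theory Num.Theory.
Import numFieldNormedType.Exports.
Local Open Scope ring_scope.

(* The stationarity condition in L_u reads
     P_U(u) 2 K L_u + xi(u) sqrt P_X + P_U(u) mu = 0.
   The vector sqrt P_X is a unit eigenvector of V and Lambda (eigenvalue 1),
   hence of the symmetric K, so K L_u is orthogonal to it like L_u.  Pairing
   the condition with sqrt P_X gives xi(u) = - P_U(u) <sqrt P_X, mu>; summing
   it over u and using sum_u P_U(u) L_u = 0 gives mu.  Substituting both
   leaves P_U(u) K L_u = 0. *)

(** * Bilinearity and the adjoint rule for the inner product *)

Section Dot.
Context {R : realType}.

Lemma dotDl n (a b c : 'cV[R]_n) : dot (a + b) c = dot a c + dot b c.
Proof. by rewrite /dot linearD /= mulmxDl mxE. Qed.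

Lemma dotDr n (a b c : 'cV[R]_n) : dot c (a + b) = dot c a + dot c b.
Proof. by rewrite /dot mulmxDr mxE. Qed.

Lemma dotZl n k (a b : 'cV[R]_n) : dot (k *: a) b = k * dot a b.
Proof. by rewrite /dot linearZ /= -scalemxAl mxE. Qed.

Lemma dotZr n k (a b : 'cV[R]_n) : dot a (k *: b) = k * dot a b.
Proof. by rewrite /dot -scalemxAr mxE. Qed.

Lemma dot0r n (a : 'cV[R]_n) : dot a 0 = 0.
Proof. by rewrite /dot mulmx0 mxE. Qed.

Lemma dotC n (a b : 'cV[R]_n) : dot a b = dot b a.
Proof. by rewrite /dot -[in LHS](trmxK b) -trmx_mul mxE. Qed.

Lemma dot_mulmxr m n (M : 'M[R]_(m, n)) (a : 'cV[R]_m) (b : 'cV[R]_n) :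
  dot a (M *m b) = dot (M^T *m a) b.
Proof. by rewrite /dot trmx_mul trmxK mulmxA. Qed.

Lemma dot_delta n (a : 'cV[R]_n) i : dot a (delta_mx i 0) = a i 0.
Proof. by rewrite /dot -colE !mxE. Qed.

Lemma qformE n (M : 'M[R]_n) a : qform M a = dot a (M *m a).
Proof. by rewrite /qform /dot mulmxA. Qed.

End Dot.

(** * Gradients of quadratic functions from directional derivatives *)

Section Gradient.
Local Open Scope classical_set_scope.
Context {R : realType}.

(** For [h != 0] the difference quotient is exactly [p + h * q], so its limit is read off
    directly. *)
Lemma derive_quadratic n (f : 'cV[R]_n -> R) (a v : 'cV[R]_n) (p q : R) :
  (forall h, f (h *: v + a) = f a + h * p + h ^+ 2 * q) -> 'D_v f a = p.
Proof.
move=> fE; apply: cvg_lim => //.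
have : (fun h : R => p + h * q) @ 0^' --> p.
  rewrite -[X in _ --> X]addr0 -[X in _ --> _ + X](mul0r q).
  apply: cvgD; first exact: cvg_cst.
  by apply: cvgMr_tmp; exact: cvg_within.
apply: cvg_trans; apply: near_eq_cvg; near=> h.
have h0 : h != 0 by near: h; exact: nbhs_dnbhs_neq.
by rewrite /= fE /GRing.scale /=; field.
Unshelve. all: by end_near. Qed.

Lemma gradient_quadratic n (c : R) (M : 'M[R]_n) (w a : 'cV[R]_n) :
  gradient (fun l => c + qform M l + dot w l) a = (M + M^T) *m a + w.
Proof.
apply/matrixP => i j; rewrite ord1 mxE -dot_delta.
apply: (derive_quadratic (q := qform M (delta_mx i 0))) => h.
rewrite !qformE !(mulmxDr, mulmxDl, dotDl, dotDr) -!scalemxAr.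
rewrite !(dotZl, dotZr).
(* The two cross terms, with [M] applied to [a] and to the basis vector, yield the entries of
   [M *m a] and [M^T *m a]. *)
rewrite [dot (M *m a) _]dotC (dot_mulmxr M a (delta_mx i 0)).
ring.
Qed.

End Gradient.

(** * Divergence transfer matrices and their fixed vector *)

Section DivergenceTransfer.
Context {R : realType}.

Lemma sqrt_diag_sqrt_vec n (P : 'cV[R]_n) :
  (forall i, 0 <= P i 0) -> sqrt_diag P *m sqrt_vec P = P.
Proof.
move=> P0; apply/matrixP => i j; rewrite ord1 mul_diag_mx !mxE.
by rewrite -expr2 sqr_sqrtr.
Qed.

Lemma dot_sqrt_vec n (P : 'cV[R]_n) : prob_vec P ->
  dot (sqrt_vec P) (sqrt_vec P) = 1.
Proof.
move=> [P0 P1]; rewrite /dot mxE -[RHS]P1; apply: eq_bigr => i _.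
by rewrite !mxE -expr2 sqr_sqrtr.
Qed.

Lemma sqrt_diag_const1 n (P : 'cV[R]_n) :
  sqrt_diag P *m const_mx 1 = sqrt_vec P.
Proof. by apply/matrixP => i j; rewrite ord1 mul_diag_mx !mxE mulr1. Qed.

Lemma tr_sqrt_diag n (P : 'cV[R]_n) : (sqrt_diag P)^T = sqrt_diag P.
Proof. exact: tr_diag_mx. Qed.

Lemma sqrt_diag_unit n (P : 'cV[R]_n) : pos_vec P -> sqrt_diag P \in unitmx.
Proof.
move=> P0; rewrite unitmxE det_diag unitfE; apply/prodf_neq0 => i _.
by rewrite !mxE gt_eqF // sqrtr_gt0.
Qed.

Lemma col_stochastic_tr1 m n (W : 'M[R]_(m, n)) : col_stochastic W ->
  W^T *m const_mx 1 = const_mx 1 :> 'cV[R]_n.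
Proof.
move=> hW; apply/matrixP => i j; rewrite !mxE -[RHS](hW i).2.
by apply: eq_bigr => k _; rewrite !mxE mulr1.
Qed.

(** With [B = dtm W P] and [Q = W *m P], [B] sends [sqrt_vec P] to [sqrt_vec Q], and [B^T] sends it
    back because the columns of [W] sum to one. *)
Lemma gram_dtm_sqrt_vec m n (W : 'M[R]_(m, n)) (P : 'cV[R]_n) :
  pos_vec P -> col_stochastic W -> pos_vec (W *m P) ->
  (dtm W P)^T *m dtm W P *m sqrt_vec P = sqrt_vec P.
Proof.
move=> P0 hW Q0; have D_unit := sqrt_diag_unit Q0.
have -> : (dtm W P)^T *m dtm W P *m sqrt_vec P
  = (dtm W P)^T *m sqrt_vec (W *m P).
  rewrite -!mulmxA sqrt_diag_sqrt_vec; last by move=> i; exact: ltW.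
  rewrite -[X in invmx _ *m X]sqrt_diag_sqrt_vec ?mulKmx //.
  by move=> i; exact: ltW.
(* Writing [sqrt_vec Q] as [sqrt_diag Q] times the all-ones vector cancels the inverse in [B^T] and
   leaves [W^T] acting on that vector. *)
rewrite /dtm !trmx_mul trmx_inv !tr_sqrt_diag -!mulmxA.
by rewrite -(sqrt_diag_const1 (W *m P)) mulKmx // col_stochastic_tr1 //
  sqrt_diag_const1.
Qed.

Lemma gram_tr m n (B : 'M[R]_(m, n)) : (B^T *m B)^T = B^T *m B.
Proof. by rewrite trmx_mul trmxK. Qed.

End DivergenceTransfer.

(** * The Lagrangian as a function of one [L u] *)

Section Stationarity.
Context {R : realType} {U : finType} {n : nat}.
Variables (PX : 'cV[R]_n) (V Lam : 'M[R]_n) (rate Theta eps : R).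

Lemma qform_Kmx nu rho (a : 'cV[R]_n) :
  qform (Kmx V Lam nu rho) a
  = - qform V a + nu * qform Lam a + rho * dot a a.
Proof.
rewrite !qformE /Kmx !mulmxDl mulNmx -scalemxAl mul_scalar_mx.
by rewrite !dotDr -scaleN1r !dotZr mulN1r.
Qed.

Lemma tr_Kmx nu rho : V^T = V -> Lam^T = Lam ->
  (Kmx V Lam nu rho)^T = Kmx V Lam nu rho.
Proof.
by move=> VT LT; rewrite /Kmx !linearD linearN linearZ /= VT LT tr_scalar_mx.
Qed.

(** In [L u] alone, the Lagrangian is a constant, plus [PU u] times the quadratic form of [Kmx],
    plus a linear term; symmetry of [Kmx] produces the factor 2. *)
Lemma lagrangian_gradientE (PU : U -> R) nu rho xi mu (L : U -> 'cV[R]_n) u :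
  V^T = V -> Lam^T = Lam ->
  lagrangian_gradient PX V Lam rate Theta eps PU nu rho xi mu L u
  = (2 * PU u) *: (Kmx V Lam nu rho *m L u)
    + (xi u *: sqrt_vec PX + PU u *: mu).
Proof.
move=> VT LT; rewrite /lagrangian_gradient.
pose rest (F : U -> 'cV[R]_n -> R) := \sum_(v | v != u) F v (L v).
have sumE (F : U -> 'cV[R]_n -> R) l :
    \sum_v F v ([eta L with u |-> l] v) = F u l + rest F.
  rewrite (bigD1 u) //= eqxx; congr (_ + _).
  by apply: eq_bigr => v /negbTE /= ->.
(* [c] gathers what does not depend on [l]: the summands of the other letters and the constraint
   bounds. *)
pose c := - rest (fun v l => PU v * qform V l)
  + nu * (rest (fun v l => PU v * qform Lam l) - 2 * Theta / eps ^+ 2)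
  + rho * (rest (fun v l => PU v * dot l l) - 2 * rate / eps ^+ 2)
  + rest (fun v l => xi v * dot (sqrt_vec PX) l)
  + rest (fun v l => PU v * dot mu l).
rewrite (_ : (fun l => _) = fun l => c + qform (PU u *: Kmx V Lam nu rho) l
    + dot (xi u *: sqrt_vec PX + PU u *: mu) l); last first.
  apply/funext => l; rewrite /lagrangian.
  rewrite (sumE (fun v l => PU v * qform V l)).
  rewrite (sumE (fun v l => PU v * qform Lam l)).
  rewrite (sumE (fun v l => PU v * dot l l)).
  rewrite (sumE (fun v l => xi v * dot (sqrt_vec PX) l)).
  rewrite (sumE (fun v l => PU v * dot mu l)).
  rewrite [qform (_ *: _) _]qformE -scalemxAl dotZr -qformE qform_Kmx.
  by rewrite dotDl !dotZl /c; ring.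
rewrite gradient_quadratic linearZ /= tr_Kmx // -scalerDl -mulr2n -[PU u *+ 2]mulr_natl.
by rewrite -scalemxAl.
Qed.

End Stationarity.

Theorem theorem2 (R : realType) (U : finType) (nX nY nZ : nat)
  (PX : 'cV[R]_nX) (WY : 'M[R]_(nY, nX)) (WZ : 'M[R]_(nZ, nX))
  (V Lam : 'M[R]_nX) (rate Theta eps : R)
  (PU : U -> R) (L : U -> 'cV[R]_nX)
  (nu rho : R) (xi : U -> R) (mu : 'cV[R]_nX)
  (hPX : prob_vec PX) (hPX0 : pos_vec PX)
  (hWY : col_stochastic WY) (hWZ : col_stochastic WZ)
  (hPY0 : pos_vec (WY *m PX)) (hPZ0 : pos_vec (WZ *m PX))
  (hV : V = (dtm WY PX)^T *m dtm WY PX)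
  (hLam : Lam = (dtm WZ PX)^T *m dtm WZ PX)
  (hrate : 0 < rate) (hTheta : 0 < Theta) (heps : 0 < eps)
  (hprimal : primal_optimal PX V Lam rate Theta eps PU L)
  (hdual : dual_optimal PX V Lam rate Theta eps PU nu rho xi mu)
  (hKKT : KKT PX V Lam rate Theta eps PU L nu rho xi mu) :
  [/\ mu = - (\sum_u xi u) *: sqrt_vec PX,
      forall u, xi u = (\sum_u' xi u') * PU u
    & forall u, 0 < PU u -> Kmx V Lam nu rho *m L u = 0].
Proof.
have VT : V^T = V by rewrite hV gram_tr.
have LT : Lam^T = Lam by rewrite hLam gram_tr.
set s := sqrt_vec PX; set K := Kmx V Lam nu rho.
(* The three terms of the eigenvalue come from [- V], [nu *: Lam] and [rho%:M]. *)
have Ks : K *m s = (- 1 + nu + rho) *: s.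
  rewrite /K /Kmx !mulmxDl mulNmx -scalemxAl mul_scalar_mx hV hLam.
  by rewrite !gram_dtm_sqrt_vec // !scalerDl scaleN1r.
have ss : dot s s = 1 by exact: dot_sqrt_vec.
have [[_ _ sL /= PUL [PU1 PU0]] _ _ _ grad0] := hKKT.
have stat u : (2 * PU u) *: (K *m L u) + (xi u *: s + PU u *: mu) = 0.
  by rewrite -(grad0 u) lagrangian_gradientE.
have sK u : dot s (K *m L u) = 0.
  by rewrite dot_mulmxr tr_Kmx // Ks dotZl sL mulr0.
have xiE u : xi u = - dot s mu * PU u.
  have /(congr1 (dot s)) := stat u.
  rewrite !dotDr !dotZr sK ss dot0r mulr0 add0r mulr1 => /eqP.
  by rewrite addr_eq0 => /eqP ->; rewrite mulNr mulrC.
(* Since [PU] sums to one, the proportionality factor in [xiE] is the total of [xi]. *)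
have sum_xi : \sum_u xi u = - dot s mu.
  by under eq_bigr do rewrite xiE; rewrite -mulr_sumr PU1 mulr1.
(* Feasibility gives this only after multiplication by [sqrt_diag PX], which positivity of [PX]
   makes invertible. *)
have PUL0 : \sum_u PU u *: L u = 0.
  rewrite -[LHS](mulKmx (sqrt_diag_unit hPX0)) mulmx_sumr.
  by under eq_bigr do rewrite -scalemxAr; rewrite PUL mulmx0.
have muE : mu = - (\sum_u xi u) *: s.
  have : \sum_u ((2 * PU u) *: (K *m L u) + (xi u *: s + PU u *: mu)) = 0.
    by rewrite big1.
  rewrite !big_split /= -!scaler_suml PU1 scale1r.
  under eq_bigr do rewrite -scalerA scalemxAr.
  rewrite -scaler_sumr -mulmx_sumr PUL0 mulmx0 scaler0 add0r => /eqP.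
  by rewrite addrC addr_eq0 scaleNr => /eqP.
split=> // u; first by rewrite sum_xi xiE.
(* The [xi] and [mu] terms cancel, leaving [2 * PU u] times [K *m L u]. Dividing needs [0 < PU u]:
   at a letter of probability zero this equation does not constrain [L u]. *)
move=> PUu; have /eqP := stat u.
rewrite muE xiE -sum_xi scalerA -scalerDl mulrN [PU u * _]mulrC subrr.
rewrite scale0r addr0 scaler_eq0 mulf_eq0 pnatr_eq0 /= gt_eqF //= => /eqP //.
Qed.
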